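(* For any metric space $X$ we have $$\dim_{ML}X=\sup\{\dim_L E: E\subset X \text{ is bounded}\}.$$
   Context: Subsets of a metric space are regarded as metric spaces with the inherited metric. For a metric space $(X,\rho)$, $B(x,r)=\{y\in X:\rho(x,y)\le r\}$ denotes the closed ball in $X$, and $N_r(A)\in\{0,1,2,\dots\}\cup\{\infty\}$ denotes the minimal number of sets of diameter at most $r$ required to cover $A\subset X$. The lower dimension of a metric space $X$ with at least two points is $$\dim_L X=\sup\Big\{\alpha\in\mathbb{R}:\ \exists\, C>0 \text{ such that for all real } 0<r<R\le\operatorname{diam}X \text{ and all } x\in X,\ N_r(B(x,R))\ge C\left(\tfrac{R}{r}\right)^{\alpha}\Big\}\in[0,\infty],$$ where $\operatorname{diam}X$ may be $\infty$. Conventions: $\dim_L\emptyset=0$, and $\dim_L X=0$ if $X$ is a one-point space. The modified lower dimension of a metric space $X$ is $\dim_{ML}X=\sup\{\dim_L E: E\subset X\}$. *)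

(* Defs.v *)
From HB Require Import structures.
From mathcomp Require Import all_boot all_order all_algebra.
From mathcomp Require Import all_classical all_reals all_analysis.

Set Implicit Arguments.
Unset Strict Implicit.
Unset Printing Implicit Defensive.

Import Order.TTheory GRing.Theory Num.Theory.
Import numFieldNormedType.Exports.

Local Open Scope classical_set_scope.
Local Open Scope ring_scope.

(* A set E coerces to the type of its elements, which the library equips with
   the initial pseudometric structure along the inclusion; the instance below
   completes it into a metric space with the inherited distance. *)
Section subset_metric.
Context (R : realType) (X : metricType R) (E : set X).

Let dist (x y : E) : R := mdist (set_val x) (set_val y).

Let dist_ge0 x y : 0 <= dist x y.
Proof. exact: mdist_ge0. Qed.

Let dist_positivity x y : dist x y = 0 -> x = y.
Proof. by move=> /mdist_positivity xy; apply: val_inj. Qed.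

Let ballEdist (x : E) (d : R) : ball x d = [set y | dist x y < d].
Proof.
apply/seteqP; split=> y; rewrite /ball/=.
  by rewrite -[X in X -> _]/(ball (set_val x) d (set_val y)) ballEmdist.
by rewrite -[X in _ -> X]/(ball (set_val x) d (set_val y)) ballEmdist.
Qed.

HB.instance Definition _ := @PseudoMetric_isMetric.Build R (set_type E)
  dist dist_ge0 dist_positivity ballEdist.

Lemma mdist_subsetE (x y : E) : mdist x y = mdist (set_val x) (set_val y).
Proof. by []. Qed.

End subset_metric.

Section lower_dimension.
Context (R : realType).
Implicit Type X : metricType R.

(* The maximum with 0 only matters for set0, whose ereal_sup is -oo. *)
Definition diam X (A : set X) : \bar R :=
  maxe 0%E (ereal_sup [set (mdist p.1 p.2)%:E | p in A `*` A]).

(* The closed_ball of the library is the closure of the open ball, which can be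
   a proper subset of this one. *)
Definition mclosed_ball X (x : X) (r : R) : set X := [set y | mdist x y <= r].

(* Infimum of a set of natural numbers: it is attained, or +oo when A has no
   finite cover by sets of diameter at most r. *)
Definition covering_number X (r : R) (A : set X) : \bar R :=
  ereal_inf [set (n%:R : R)%:E | n in [set n : nat |
    exists F : 'I_n -> set X,
      (forall i, diam (F i) <= r%:E)%E /\ A `<=` \bigcup_i F i]].

Definition lower_dim X : \bar R :=
  if `[< exists x y : X, x <> y >] then
    ereal_sup [set a%:E | a in [set a : R |
      exists2 C : R, 0 < C &
        forall r s : R, 0 < r -> r < s -> (s%:E <= diam [set: X])%E ->
          forall x : X,
            ((C * (s / r) `^ a)%:E <= covering_number r (mclosed_ball x s))%E]]
  else 0%E.

Definition modified_lower_dim X : \bar R :=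
  ereal_sup [set lower_dim E | E in [set: set X]].

Definition metric_bounded X (E : set X) : Prop := (diam E < +oo)%E.

End lower_dimension.

(* Main.v *)
(* If the lower dimension of an unbounded set E exceeds a > 0, then for a small
   ratio mu every ball of E of radius mu^n contains at least mu^-a points that
   are pairwise more than 6 mu^(n+1) apart, one of them being its centre.
   Iterating from a root gives a bounded tree in which the descendants of a node
   of level n stay within 2 mu^n of it, so that siblings of level n+1 have
   descendants more than 2 mu^(n+1) apart.  As each point is its own child, every
   point of the tree has an ancestor at each level, and counting the
   l-th generation below that ancestor gives lower dimension at least a. *)
Require Import Defs.
From mathcomp Require Import all_boot all_order all_algebra.
From mathcomp Require Import all_classical all_reals all_analysis.
From mathcomp Require Import lra.

Import Order.TTheory GRing.Theory Num.Theory.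

Local Open Scope classical_set_scope.
Local Open Scope ring_scope.

(** * Covering numbers and separated points *)

Section covering.
Context {R : realType}.
Implicit Types (X : metricType R) (r : R).

Lemma mdist_le_diam X (A : set X) x y :
  A x -> A y -> ((mdist x y)%:E <= diam A)%E.
Proof.
move=> Ax Ay; rewrite /diam le_max; apply/orP; right.
by apply: ereal_sup_ubound; exists (x, y).
Qed.

Lemma diam_le X (A : set X) (d : R) : 0 <= d ->
  (forall x y, A x -> A y -> mdist x y <= d) -> (diam A <= d%:E)%E.
Proof.
move=> d0 Ad; rewrite /diam ge_max lee_fin d0 /=.
apply: ge_ereal_sup => _ [[x y] [/= Ax Ay] <-].
by rewrite lee_fin; exact: Ad.
Qed.

(** A set of diameter at most [r] contains at most one of the points [q t], so picking a covering
    set around each of them is injective. *)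
Lemma card_le_covering_number X r (A : set X) (T : finType) (q : T -> X) :
  (forall t, A (q t)) ->
  (forall t u, t != u -> r < mdist (q t) (q u)) ->
  ((#|T|%:R : R)%:E <= covering_number r A)%E.
Proof.
move=> Aq sep; apply: le_ereal_inf_tmp => _ [n [F [Fr AF]] <-].
rewrite lee_fin ler_nat.
have /choice[f fF] : forall t, exists i : 'I_n, F i (q t).
  by move=> t; have [i _ Fi] := AF _ (Aq t); exists i.
have /leq_card : injective f.
  move=> t u ftu; apply/eqP/negPn/negP => /sep; apply/negP; rewrite -leNgt.
  rewrite -lee_fin; apply: le_trans (Fr (f t)).
  by apply: mdist_le_diam => //; rewrite ftu.
by rewrite card_ord.
Qed.

Lemma covering_number_ge1 X r (A : set X) x :
  A x -> (1 <= covering_number r A)%E.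
Proof.
move=> Ax; have := @card_le_covering_number X r A unit (fun=> x).
by rewrite card_unit; apply.
Qed.

(** Greedy choice starting at [x]: closed balls of radius [r / 2] have diameter at most [r], so [n]
    or fewer of them cannot cover [A], and an uncovered point can be added. *)
Lemma exists_separated X r (A : set X) x n : 0 <= r -> A x ->
  ((n.+1%:R : R)%:E <= covering_number r A)%E ->
  exists g : 'I_n.+1 -> X, [/\ g ord0 = x, forall i, A (g i) &
    forall i j, i != j -> r / 2 < mdist (g i) (g j)].
Proof.
move=> r0 Ax nA.
suff [g [g0 gA gsep]] : exists g : nat -> X, [/\ g 0%N = x,
    forall i, A (g i) &
    forall i j, (i < j <= n)%N -> r / 2 < mdist (g i) (g j)].
  exists (fun i => g i); split => // i j.
  rewrite -val_eqE /= neq_ltn => /orP[ij|ji].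
    by apply: gsep; rewrite ij -ltnS ltn_ord.
  by rewrite metric_sym; apply: gsep; rewrite ji -ltnS ltn_ord.
suff : forall m, (m <= n)%N -> exists g : nat -> X, [/\ g 0%N = x,
    forall i, A (g i) &
    forall i j, (i < j <= m)%N -> r / 2 < mdist (g i) (g j)] by apply.
elim=> [_|m IHm mn].
  exists (fun=> x); split => // i j; rewrite leqn0 => /andP[ij /eqP j0].
  by rewrite j0 in ij.
have [g [g0 gA gsep]] := IHm (ltnW mn).
have [y [Ay ysep]] : exists y, A y /\ forall i, (i <= m)%N ->
    r / 2 < mdist (g i) y.
  apply: contrapT => noy.
  suff : (covering_number r A <= (m.+1%:R : R)%:E)%E.
    by move=> /(le_trans nA); rewrite lee_fin ler_nat ltnS leqNgt mn.
  apply: ge_ereal_inf; exists (m.+1%:R)%:E => //.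
  exists m.+1 => //; exists (fun i => mclosed_ball (g i) (r / 2)); split.
    move=> i; apply: diam_le => // u v; rewrite /mclosed_ball /= => iu iv.
    have := metric_triangle u (g i) v; rewrite (metric_sym u (g i)); lra.
  move=> y Ay; apply: contrapT => ny; apply: noy; exists y; split => // i im.
  rewrite ltNge; apply/negP => iy; apply: ny.
  by exists (Ordinal (im : (i < m.+1)%N)).
exists (fun i => if (i <= m)%N then g i else y); split => //.
  by move=> i; case: ifP.
move=> i j /andP[ij jm]; rewrite -ltnS (leq_trans ij jm); case: ifPn => jm'.
  by apply: gsep; rewrite ij.
by apply: ysep; rewrite -ltnS (leq_trans ij jm).
Qed.

Lemma lower_dim_set0 X : lower_dim (set0 : set X) = 0%E.
Proof.
rewrite /lower_dim; case: asboolP => // -[x _].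
by have := set_valP x.
Qed.

End covering.

(** * Bounded sets coded by digit sequences and their lower dimension *)

Lemma exists_expr_between (R : realType) (mu t : R) :
  0 < mu < 1 -> 0 < t <= 1 -> exists l, mu ^+ l.+1 <= t <= mu ^+ l.
Proof.
move=> /andP[mu0 mu1] /andP[t0 t1].
have exn : exists n, mu ^+ n <= t.
  have /cvgrPdist_lt/(_ _ t0) [n _ /(_ n (leqnn n))] /= :
      (mu ^+ n @[n --> \oo] --> 0)%classic.
    by apply: cvg_expr; rewrite gtr0_norm.
  by rewrite sub0r normrN gtr0_norm ?exprn_gt0// => /ltW; exists n.
case: (ex_minnP exn) => -[|n] mun nmin.
  (* If the least exponent is 0, then [t = 1]. *)
  exists 0%N; rewrite expr0 t1 andbT (le_trans _ mun)//.
  by rewrite expr1 expr0 ltW.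
exists n; rewrite mun /= leNgt; apply/negP => /ltW /nmin.
by rewrite ltnn.
Qed.

(* Points [p c n] indexed by an infinite code [c] and a length [n]; only the
   first [n] digits of [c] matter, and a digit 0 leaves the point in place. *)
Section coded_points.
Context {R : realType} {X : metricType R} {m : nat} {mu : R}.
Variable p : (nat -> 'I_m.+1) -> nat -> X.
Hypothesis mu01 : 0 < mu < 1.
Hypothesis p_prefix : forall c c' n,
  (forall j, (j < n)%N -> c j = c' j) -> p c n = p c' n.
Hypothesis p_stable : forall c n n', (n <= n')%N ->
  (forall j, (n <= j)%N -> c j = ord0) -> p c n' = p c n.
Hypothesis p_near : forall c n n', (n <= n')%N ->
  mdist (p c n) (p c n') <= 2 * mu ^+ n.
Hypothesis p_far : forall c c' k n n', (forall j, (j < k)%N -> c j = c' j) ->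
  c k != c' k -> (k < n)%N -> (k < n')%N ->
  2 * mu ^+ k.+1 < mdist (p c n) (p c' n').

Definition coded_set : set X := [set y | exists c n, y = p c n].

(** Both points lie within [2 * mu ^+ k] of their common ancestor [p c k]. *)
Lemma coded_common_prefix c c' k n n' : (forall j, (j < k)%N -> c j = c' j) ->
  (k <= n)%N -> (k <= n')%N -> mdist (p c n) (p c' n') <= 4 * mu ^+ k.
Proof.
move=> cc' kn kn'; have := metric_triangle (p c n) (p c k) (p c' n').
rewrite (metric_sym (p c n) (p c k)) {2}(p_prefix _ _ _ cc').
have := p_near c k n kn; have := p_near c' k n' kn'; lra.
Qed.

Lemma coded_set_mdist_le x y :
  coded_set x -> coded_set y -> mdist x y <= 4.
Proof.
move=> [c [n ->]] [c' [n' ->]].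
by have := @coded_common_prefix c c' 0 n n'; rewrite expr0 mulr1; apply.
Qed.

Lemma coded_set_bounded : metric_bounded coded_set.
Proof.
rewrite /metric_bounded; apply: (@le_lt_trans _ _ (4 : R)%:E); last exact: ltry.
by apply: diam_le => // x y; exact: coded_set_mdist_le.
Qed.

(** The words of length [l] appended to the first [k] digits of [x] give [m.+1 ^ l] points of the
    ball that are pairwise more than [r] apart. *)
Lemma coded_set_covering_number (x : coded_set) (r s : R) k l :
  4 * mu ^+ k <= s -> r <= 2 * mu ^+ (k + l) ->
  (((m.+1 ^ l)%:R : R)%:E <= covering_number r (mclosed_ball x s))%E.
Proof.
move=> ks rkl.
have [c [n xE]] := set_valP x.
(* Padding the code of [x] with zeros does not move the point, so [x] has an ancestor at level [k]
   even when [n < k]. *)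
pose c0 j := if (j < n)%N then c j else ord0.
have xE0 n' : (n <= n')%N -> set_val x = p c0 n'.
  move=> nn'; rewrite (p_stable _ _ _ nn') => [|j nj].
    by apply: (etrans xE); apply: p_prefix => j jn; rewrite /c0 jn.
  by rewrite /c0 ltnNge nj.
pose cw (w : l.-tuple 'I_m.+1) j :=
  if (j < k)%N then c0 j else nth ord0 w (j - k).
have cwF w : coded_set (p (cw w) (k + l)%N) by exists (cw w), (k + l)%N.
pose q w : coded_set := SigSub (mem_set (cwF w)).
have qE w : set_val (q w) = p (cw w) (k + l)%N by [].
rewrite -[X in (X ^ l)%N]card_ord -card_tuple.
apply: (@card_le_covering_number _ _ _ _ _ q) => [w|w w' ww'].
  rewrite /mclosed_ball /= mdist_subsetE qE (xE0 (maxn n k)) ?leq_maxl//.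
  apply: le_trans ks; apply: coded_common_prefix; rewrite ?leq_maxr ?leq_addr//.
  by move=> j jk; rewrite /cw jk.
rewrite mdist_subsetE !qE.
(* The first digit where the words differ separates the points. Past position [l] both words read
   the default [ord0], so that digit lies before [l]. *)
have exi : exists i, nth ord0 w i != nth ord0 w' i.
  apply: contrapT => noi; move/eqP: ww'; apply; apply/val_inj.
  apply: (@eq_from_nth _ ord0) => [|i _]; first by rewrite !size_tuple.
  by apply/eqP/negPn/negP => wi; apply: noi; exists i.
case: (ex_minnP exi) => i wi imin.
have il : (i < l)%N.
  rewrite ltnNge; apply/negP => li; move: wi.
  by rewrite !nth_default ?size_tuple// eqxx.
apply: (@le_lt_trans _ _ (2 * mu ^+ (k + i).+1)).
  apply: le_trans rkl _; rewrite ler_pM2l//.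
  have /andP[mu0 mu1] := mu01.
  by rewrite ler_wiXn2l ?(ltW mu0) ?(ltW mu1)// -addnS leq_add2l.
apply: p_far; rewrite ?ltn_add2l//.
  move=> j jki; rewrite /cw; case: ifPn => //; rewrite -leqNgt => kj.
  apply/eqP/negPn/negP => /imin; rewrite leqNgt => /negP; apply.
  by rewrite ltn_subLR.
by rewrite /cw ltnNge leq_addr /= addKn.
Qed.

Lemma coded_set_lower_dim_ge (a : R) : 0 < a -> (0 < m)%N ->
  mu `^ (- a) <= m.+1%:R -> (a%:E <= lower_dim coded_set)%E.
Proof.
move=> a0 m0 mum; have /andP[mu0 mu1] := mu01.
rewrite /lower_dim; case: asboolP => [_|]; last first.
  (* Since [0 < m], the digits [ord0] and [ord_max] differ and give two distinct points of level
     1. *)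
  case; pose c i := fun _ : nat => i : 'I_m.+1.
  have cF i : coded_set (p (c i) 1%N) by exists (c i), 1%N.
  exists (SigSub (mem_set (cF ord0))), (SigSub (mem_set (cF ord_max))).
  move=> /(congr1 set_val) /= e.
  have : 2 * mu ^+ 1 < mdist (p (c ord0) 1%N) (p (c ord_max) 1%N).
    by apply: (@p_far _ _ 0%N) => //; rewrite /c -val_eqE /= neq_ltn m0.
  rewrite -[p (c ord0) 1%N]/(set_val (SigSub (mem_set (cF ord0)))) e.
  by rewrite mdistxx expr1; lra.
apply: ereal_sup_ubound; exists a => //.
(* With [s <= 4 * mu ^+ k] and [r >= 2 * mu ^+ (k + l + 2)], as arranged below,
   [mu ^+ 2 / 2 * (s / r)] is at most [mu ^- l]. *)
exists ((mu ^+ 2 / 2) `^ a).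
  by rewrite powR_gt0// divr_gt0// exprn_gt0.
move=> r s r0 rs sdiam x.
have s4 : s <= 4.
  rewrite -lee_fin (le_trans sdiam)//; apply: diam_le => // u v _ _.
  by rewrite mdist_subsetE; apply: coded_set_mdist_le; exact: set_valP.
have s0 : 0 < s := lt_trans r0 rs.
have [k /andP[ks sk]] : exists k, mu ^+ k.+1 <= s / 4 <= mu ^+ k.
  by apply: exists_expr_between => //; lra.
have muk n : 0 < mu ^+ n by rewrite exprn_gt0.
(* Generations are counted from level [k.+1], where [4 * mu ^+ k.+1 <= s]. If [r] exceeds
   [2 * mu ^+ k.+1], then [l = 0] and the trivial bound 1 suffices. *)
have [l rl lr] : exists2 l, r <= 2 * mu ^+ (k.+1 + l) \/ l = 0%N
    & 2 * mu ^+ (k.+1 + l.+1) <= r.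
  have [rk|rk] := lerP r (2 * mu ^+ k.+1).
    have d0 : 0 < 2 * mu ^+ k.+1 by rewrite mulr_gt0.
    have [l] : exists l, mu ^+ l.+1 <= r / (2 * mu ^+ k.+1) <= mu ^+ l.
      by apply: exists_expr_between => //; rewrite divr_gt0// ler_pdivrMr// mul1r.
    rewrite ler_pdivlMr// ler_pdivrMr// => /andP[lr rl].
    exists l; first left; by rewrite exprD; lra.
  exists 0%N; first by right.
  rewrite exprD expr1; have := muk k.+1; nra.
apply: (@le_trans _ _ ((m.+1 ^ l)%:R : R)%:E); last first.
  case: rl => [rl|->]; last first.
    apply: (@covering_number_ge1 _ _ _ _ x).
    by rewrite /mclosed_ball /= mdistxx ltW.
  by apply: coded_set_covering_number rl; lra.
have [r_ge0 s_ge0 mu_ge0] := And3 (ltW r0) (ltW s0) (ltW mu0).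
rewrite lee_fin natrX -powRM ?divr_ge0 ?exprn_ge0//.
apply: (@le_trans _ _ ((mu ^- l) `^ a)).
  apply: ge0_ler_powR; rewrite ?nnegrE ?invr_ge0 ?mulr_ge0 ?invr_ge0 ?exprn_ge0//.
    exact: ltW.
  rewrite -[leRHS]mul1r ler_pdivlMr// [_ * (s / r)]mulrA mulrAC ler_pdivrMr// mul1r.
  apply: le_trans lr; rewrite exprD [mu ^+ l.+1]exprS [mu ^+ k.+1]exprS.
  have := muk l; have := muk k; set u := mu ^+ k; set v := mu ^+ l => u0 v0.
  have : mu ^+ 2 * v * (s / 4) <= mu ^+ 2 * v * u.
    by rewrite ler_pM2l// mulr_gt0.
  rewrite expr2; lra.
rewrite -exprVn -(powR_mulrn l (_ : 0 <= mu^-1)) ?invr_ge0// -powRrM.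
rewrite mulrC powRrM powR_mulrn ?powR_ge0// lerXn2r ?nnegrE ?powR_ge0//.
apply: le_trans mum.
by rewrite -powR_inv1// -powRrM mulN1r.
Qed.

End coded_points.

(** * The tree of iterated children *)

Section tree.
Context {R : realType} {Y : metricType R} {m : nat} {mu : R}.
Variables (child : nat -> Y -> 'I_m.+1 -> Y) (root : Y).
Hypothesis mu0 : 0 < mu.
Hypothesis mu2 : mu <= 1 / 2.
Hypothesis child0 : forall n x, child n x ord0 = x.
Hypothesis child_near : forall n x i, mdist x (child n x i) <= mu ^+ n.
Hypothesis child_far : forall n x i j, i != j ->
  6 * mu ^+ n.+1 < mdist (child n x i) (child n x j).

Fixpoint node (c : nat -> 'I_m.+1) n : Y :=
  if n is n'.+1 then child n' (node c n') (c n') else root.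

Lemma node_prefix c c' n :
  (forall j, (j < n)%N -> c j = c' j) -> node c n = node c' n.
Proof.
elim: n => //= n IHn cc'; rewrite cc'// IHn// => j jn.
by apply: cc'; rewrite ltnW.
Qed.

Lemma node_stable c n n' : (n <= n')%N ->
  (forall j, (n <= j)%N -> c j = ord0) -> node c n' = node c n.
Proof.
move=> /subnKC <- c0; elim: (n' - n)%N => [|d IHd]; first by rewrite addn0.
by rewrite addnS /= c0 ?leq_addr// child0.
Qed.

Lemma node_near c n n' : (n <= n')%N ->
  mdist (node c n) (node c n') <= 2 * mu ^+ n.
Proof.
move=> /subnKC <-.
(* This stronger bound telescopes, since [mu <= 1 / 2] gives
   [mu ^+ j <= 2 * mu ^+ j - 2 * mu ^+ j.+1]. *)
suff: mdist (node c n) (node c (n + (n' - n))) <=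
    2 * mu ^+ n - 2 * mu ^+ (n + (n' - n)).
  have : 0 <= mu ^+ (n + (n' - n)) by rewrite exprn_ge0// ltW.
  lra.
elim: (n' - n)%N => [|d IHd]; first by rewrite addn0 mdistxx subrr.
rewrite addnS /= exprS.
have := metric_triangle (node c n) (node c (n + d))
  (child (n + d) (node c (n + d)) (c (n + d)%N)).
have := child_near (n + d) (node c (n + d)) (c (n + d)%N).
have : mu * mu ^+ (n + d) <= 1 / 2 * mu ^+ (n + d).
  by rewrite ler_wpM2r// exprn_ge0// ltW.
lra.
Qed.

(** The ancestors at level [k.+1] are more than [6 * mu ^+ k.+1] apart, and each descendant strays
    from its own by at most [2 * mu ^+ k.+1]. *)
Lemma node_far c c' k n n' : (forall j, (j < k)%N -> c j = c' j) ->
  c k != c' k -> (k < n)%N -> (k < n')%N ->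
  2 * mu ^+ k.+1 < mdist (node c n) (node c' n').
Proof.
move=> cc' ck kn kn'.
have := child_far k (node c k) _ _ ck.
have := node_near c _ _ kn; have := node_near c' _ _ kn'.
rewrite /= -(node_prefix _ _ _ cc').
set u := child _ _ (c k); set v := child _ _ (c' k).
have := metric_triangle u (node c n) v.
have := metric_triangle (node c n) (node c' n') v.
rewrite (metric_sym (node c' n') v); lra.
Qed.

End tree.

(* [mu] is the ratio between successive scales and [m.+1] the number of
   children: the upper bound on [m.+1] makes the children fit, the lower one
   gives the dimension. *)
Lemma exists_ratio (R : realType) (a b C : R) : 0 < a < b -> 0 < C ->
  exists (mu : R) (m : nat), [/\ 0 < mu <= 1 / 13, (0 < m)%N,
    mu `^ (- a) <= m.+1%:R & m.+1%:R <= C * ((12 * mu)^-1) `^ b].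
Proof.
move=> /andP[a0 ab] C0.
have ba0 : 0 < b - a by rewrite subr_gt0.
pose K := 2 * 12 `^ b / C.
pose t := (Num.max K (13 `^ (b - a))) `^ (b - a)^-1.
have M0 : 0 <= Num.max K (13 `^ (b - a)) by rewrite le_max powR_ge0 orbT.
have tK : K <= t `^ (b - a).
  by rewrite -powRrM mulVf ?gt_eqF// powRr1// le_max lexx.
have t13 : 13 <= t.
  have -> : 13 = (13 `^ (b - a)) `^ (b - a)^-1 :> R.
    by rewrite -powRrM mulfV ?gt_eqF// powRr1.
  apply: ge0_ler_powR; rewrite ?nnegrE ?powR_ge0 ?invr_ge0 ?(ltW ba0)//.
  by rewrite le_max lexx orbT.
have t0 : 0 < t by lra.
have ta1 : 1 < t `^ a.
  have <- : 1 `^ a = 1 :> R by rewrite powR1.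
  apply: gt0_ltr_powR => //; rewrite ?nnegrE; lra.
exists t^-1, (Num.truncn (t `^ a)).
have /andP[tl tu] := truncn_itv (powR_ge0 t a).
have taV : t^-1 `^ (- a) = t `^ a.
  by rewrite -powR_inv1 ?ltW// -powRrM mulrNN mul1r.
split.
- by rewrite invr_gt0 t0 mul1r lef_pV2 ?posrE.
- by rewrite lt0n; apply/eqP => e; move: tu; rewrite e; lra.
- by rewrite taV ltW.
- apply: (@le_trans _ _ (2 * t `^ a)); first by rewrite -natr1; lra.
  have -> : (12 / t)^-1 `^ b = t `^ a * t `^ (b - a) / 12 `^ b.
    rewrite -powRD ?(lt0r_neq0 t0) ?implybT// [a + _]addrC subrK.
    rewrite invf_div powRM ?invr_ge0 ?ltW// -[12^-1]powR_inv1// -powRrM.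
    by rewrite mulN1r powRN.
  have d0 : 0 < 12 `^ b :> R by rewrite powR_gt0.
  move: tK; rewrite /K ler_pdivrMr// => tK.
  rewrite mulrA ler_pdivlMr//.
  have : t `^ a * (2 * 12 `^ b) <= t `^ a * (t `^ (b - a) * C).
    by rewrite ler_wpM2l// powR_ge0.
  lra.
Qed.

(** * Extraction of a bounded subset and the equality of suprema *)

Lemma bounded_subset_lower_dim_ge (R : realType) (X : metricType R)
    (E : set X) (x : E) (a b C : R) : 0 < a < b -> 0 < C ->
  (forall r s : R, 0 < r -> r < s -> forall x : E,
    ((C * (s / r) `^ b)%:E <= covering_number r (mclosed_ball x s))%E) ->
  exists F : set X, metric_bounded F /\ (a%:E <= lower_dim F)%E.
Proof.
move=> ab C0 EC; have a0 : 0 < a by case/andP: ab.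
have [mu [m [/andP[mu0 mu13] m0 mum mC]]] := exists_ratio _ _ _ _ ab C0.
have mu2 : mu <= 1 / 2 by lra.
have mu01 : 0 < mu < 1 by lra.
have /choice[g gP] : forall ny : nat * E, exists g : 'I_m.+1 -> E,
    [/\ g ord0 = ny.2, forall i, mclosed_ball ny.2 (mu ^+ ny.1) (g i) &
    forall i j, i != j -> (12 * mu * mu ^+ ny.1) / 2 < mdist (g i) (g j)].
  move=> [n y] /=.
  have mun : 0 < mu ^+ n by rewrite exprn_gt0.
  apply: exists_separated; first by rewrite !mulr_ge0// ltW.
    by rewrite /mclosed_ball /= mdistxx ltW.
  (* The greedy choice halves the separation, so the scale [12 * mu ^+ n.+1] yields the required
     [6 * mu ^+ n.+1]. It is below the radius [mu ^+ n] because [mu <= 1 / 13]. *)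
  apply: le_trans (EC (12 * mu * mu ^+ n) (mu ^+ n) _ _ y); last first.
  - nra.
  - by rewrite !mulr_gt0.
  by rewrite lee_fin [12 * mu * _]mulrC invfM mulrA divff ?gt_eqF// mul1r.
pose child n y := g (n, y).
have child0 n y : child n y ord0 = y by case: (gP (n, y)).
have child_near n y i : mdist y (child n y i) <= mu ^+ n.
  by case: (gP (n, y)) => _ /(_ i).
have child_far n y i j : i != j ->
    6 * mu ^+ n.+1 < mdist (child n y i) (child n y j).
  by move=> ij; case: (gP (n, y)) => _ _ /(_ i j ij); rewrite exprS /=; lra.
(* The tree grows inside the subspace [E], and the inclusion into [X] preserves distances. *)
pose p c n : X := set_val (node child x c n).
have p_prefix c c' n : (forall j, (j < n)%N -> c j = c' j) -> p c n = p c' n.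
  by move=> /node_prefix e; rewrite /p e.
have p_stable c n n' : (n <= n')%N ->
    (forall j, (n <= j)%N -> c j = ord0) -> p c n' = p c n.
  by move=> nn' c0; rewrite /p (node_stable child x child0 _ _ _ nn' c0).
have p_near := node_near child x mu0 mu2 child_near.
have p_far := node_far child x mu0 mu2 child_near child_far.
exists (coded_set p); split; first exact: (coded_set_bounded _ p_prefix p_near).
exact: (coded_set_lower_dim_ge _ mu01 p_prefix p_stable p_near p_far).
Qed.

Theorem corollary1p5 (R : realType) (X : metricType R) :
  modified_lower_dim X =
    ereal_sup [set lower_dim E | E in [set E : set X | metric_bounded E]].
Proof.
apply/eqP; rewrite eq_le; apply/andP; split; last first.
  by apply: ereal_sup_le => _ [E _ <-]; exists E.
set S := ereal_sup _.
(* The empty set is bounded. This bound settles the default value 0 of [lower_dim] and the exponents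
   [b - e <= 0]. *)
have S0 : (0 <= S)%E.
  rewrite -(lower_dim_set0 X); apply: ereal_sup_ubound; exists set0 => //.
  rewrite /= /metric_bounded; apply: (@le_lt_trans _ _ (0 : R)%:E).
    exact: diam_le.
  exact: ltry.
apply: ge_ereal_sup => _ [E _ <-].
have [Ebd|Eunb] := pselect (metric_bounded E).
  by apply: ereal_sup_ubound; exists E.
rewrite {1}/lower_dim; case: asboolP => [[x _]|_ //].
apply: ge_ereal_sup => _ [b [C C0 EC] <-].
(* Unboundedness in [X] passes to [E] as a space of its own, so the scale restriction [s <= diam] in
   [EC] always holds. *)
have Einf : diam [set: E] = +oo%E.
  apply: contrapT => Efin; apply: Eunb; rewrite /metric_bounded ltey.
  apply/eqP => Einf; apply: Efin; apply/eqP; rewrite -leye_eq -Einf.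
  rewrite {1}/diam ge_max; apply/andP; split.
    by rewrite /diam le_max lexx.
  apply: ge_ereal_sup => _ [[y z] [/= Ey Ez] <-].
  have := @mdist_le_diam _ _ [set: E] (SigSub (mem_set Ey))
    (SigSub (mem_set Ez)) I I.
  by rewrite mdist_subsetE.
(* An arbitrarily small loss [e] makes room for the strict inequality [a < b] in the tree
   construction. *)
apply/lee_addgt0Pr => e e0; rewrite -leeBlDr// -EFinB.
have [be|be] := lerP (b - e) 0; first by rewrite (le_trans _ S0)// lee_fin.
have [F [Fbd Fdim]] : exists F : set X,
    metric_bounded F /\ ((b - e)%:E <= lower_dim F)%E.
  apply: (@bounded_subset_lower_dim_ge _ _ E x _ b C) => //.
    by rewrite be ltrBlDr ltrDl.
  by move=> r s r0 rs y; apply: EC => //; rewrite Einf leey.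
by apply: le_trans Fdim _; apply: ereal_sup_ubound; exists F.
Qed.
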